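(* Let $n\ge 1$ and let $\{X^u\}_{u\in\mathbb{N}^n}$ be a one-critical, exhaustive $n$-parameter filtration of a cell complex $X$. Then, for all $q\in\mathbb{N}$, $$\bigcup_{i=0}^n \operatorname{supp}\xi_i^q \subseteq \overline{\mathcal{G}(X_{q+1})}\cup\overline{\mathcal{G}(X_q)}.$$ Furthermore, $\operatorname{supp}\xi_0^q\subseteq\overline{\mathcal{G}(X_q)}$ and $\operatorname{supp}\xi_n^q\subseteq\overline{\mathcal{G}(X_{q+1})}$ for all $q\in\mathbb{N}$.
   Context: $\mathbb{F}$ is a fixed field, $\mathbb{N}=\{0,1,\dots\}$, $[n]=\{1,\dots,n\}$, $e_1,\dots,e_n$ is the standard basis of $\mathbb{N}^n$, and $\preceq$ is the coordinatewise order on $\mathbb{N}^n$, with least upper bound $\bigvee$. A cell complex is a finite graded set $X=\bigsqcup_{q\in\mathbb{N}}X_q$ (elements of $X_q$ are $q$-cells) with an incidence function $\kappa:X\times X\to\mathbb{F}$ such that $\kappa(\tau,\sigma)\neq0$ implies $\dim\tau=\dim\sigma+1$, and $\sum_{\rho\in X}\kappa(\tau,\rho)\kappa(\rho,\sigma)=0$ for all $\tau,\sigma$. The face partial order $\le$ on $X$ is generated by $\sigma<\tau$ whenever $\kappa(\tau,\sigma)\ne0$. $C_*(X)$ is the chain complex with $C_q(X)$ the $\mathbb{F}$-vector space with basis $X_q$ and $\partial_q(\tau)=\sum_{\sigma\in X_{q-1}}\kappa(\tau,\sigma)\sigma$. A subcomplex is a subset closed under passing to faces, with the restricted incidence function.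 $H_q$ denotes homology. An $n$-parameter filtration of $X$ is a family of subcomplexes $\{X^u\}_{u\in\mathbb{N}^n}$ with $X^u\subseteq X^v$ for $u\preceq v$; one sets $X^w=\emptyset$ if $w\notin\mathbb{N}^n$. It is exhaustive if $X=\bigcup_uX^u$. A grade $u$ is an entrance grade of a cell $\sigma$ if $\sigma\in X^u\setminus\bigcup_{j=1}^nX^{u-e_j}$. The filtration is one-critical if $X^u=\{\sigma\in X\mid h(\sigma)\preceq u\}$ for some order-preserving $h:(X,\le)\to(\mathbb{N}^n,\preceq)$ (equivalently, every cell has exactly one entrance grade). $S=\mathbb{F}[x_1,\dots,x_n]$; $V_q=\bigoplus_{u\in\mathbb{N}^n}H_q(X^u)$ is the $n$-graded $S$-module on which $x_i$ acts by the maps $H_q(X^u)\to H_q(X^{u+e_i})$ induced by inclusion. Its Betti tables are $\xi_i^q:\mathbb{N}^n\to\mathbb{N}$, $\xi_i^q(u)=\dim_{\mathbb{F}}(\operatorname{Tor}_i^S(V_q,\mathbb{F}))^u$, where $\mathbb{F}=S/\langle x_1,\dots,x_n\rangle$; $\operatorname{supp}\xi_i^q=\{u\mid\xi_i^q(u)\neq0\}$. $\mathcal{G}(X_q)\subseteq\mathbb{N}^n$ is the set of entrance grades of the $q$-cells, and for $G\subseteq\mathbb{N}^n$, $\overline{G}=\{\bigvee L\mid L\subseteq G \text{ finite}, L\ne\emptyset\}$. *)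

(* Defs.v *)
From HB Require Import structures.
From mathcomp Require Import all_boot all_order all_algebra.
From mathcomp.multinomials Require Import mpoly.

Set Implicit Arguments.
Unset Strict Implicit.
Unset Printing Implicit Defensive.

Import GRing.Theory.
Local Open Scope ring_scope.

(* N^n is the type 'X_{1..n} of exponent vectors: (u <= v)%MM is the          *)
(* coordinatewise order, mlcm the join and U_(j) the j-th basis vector.       *)
(* (The order (_ <= _)%O on this type is a monomial order; it is never used.) *)
(* Subsets of N^n are predicates 'X_{1..n} -> Prop.                           *)

Lemma lem_transi n (v u w : 'X_{1..n}) :
  (u <= v)%MM -> (v <= w)%MM -> (u <= w)%MM.
Proof.
move=> /mnm_lepP uv /mnm_lepP vw; apply/mnm_lepP => i.
exact: leq_trans (uv i) (vw i).
Qed.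

Definition below n (u : 'X_{1..n}) : seq 'X_{1..n} :=
  [seq val v | v <- enum {: 'X_{1..n < (mdeg u).+1}} & (val v <= u)%MM].

Lemma mem_below n (u v : 'X_{1..n}) : (v \in below u) = (v <= u)%MM.
Proof.
apply/mapP/idP => [[w + ->]|vu]; first by rewrite mem_filter => /andP[].
have lt : (mdeg v < (mdeg u).+1)%N.
  by rewrite ltnS !mdegE leq_sum // => i _; apply/mnm_lepP.
by exists (BMultinom lt); rewrite // mem_filter vu mem_enum.
Qed.

Lemma below_uniq n (u : 'X_{1..n}) : uniq (below u).
Proof.
rewrite map_inj_uniq; last exact: val_inj.
by rewrite filter_uniq // enum_uniq.
Qed.

Definition join_closure n (G : 'X_{1..n} -> Prop) (u : 'X_{1..n}) : Prop :=
  exists L : seq 'X_{1..n},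
    [/\ L <> [::], (forall g, g \in L -> G g)
      & u = \big[@mlcm n/0%MM]_(g <- L) g].

Definition supp n (xi : 'X_{1..n} -> nat) (u : 'X_{1..n}) : Prop := xi u <> 0%N.

(* The quotient Z / B of subspaces B <= Z of vT, realised on the complement   *)
(* Z :\: B of B in Z; [subq_class] is the projection Z -> Z / B.              *)

Section Subquotient.
Variables (F : fieldType) (vT : vectType F).
Implicit Types Z B : {vspace vT}.

Definition subq Z B : vectType F := subvs_of (Z :\: B)%VS.

Definition subq_class Z B : 'Hom(vT, subq Z B) :=
  (linfun (vsproj (Z :\: B)%VS) \o addv_pi1 Z B)%VF.

Definition subq_repr Z B : 'Hom(subq Z B, vT) := linfun vsval.

Lemma val_subq_class Z B z : vsval (subq_class Z B z) = addv_pi1 Z B z.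
Proof. by rewrite /subq_class comp_lfunE lfunE vsprojK // memv_pi. Qed.

Lemma subq_reprE Z B x : subq_repr Z B x = vsval x.
Proof. by rewrite lfunE. Qed.

Lemma subq_repr_mem Z B x : subq_repr Z B x \in Z.
Proof. by rewrite subq_reprE (subvP (diffvSl Z B)) ?subvsP. Qed.

Lemma subq_reprK Z B : cancel (subq_repr Z B) (subq_class Z B).
Proof.
move=> x; apply: val_inj; rewrite -[LHS]/(vsval _) val_subq_class subq_reprE.
by rewrite [addv_pi1 _ _ _]daddv_pi_id ?capv_diff ?subvsP.
Qed.

Lemma subq_class_surj Z B x : exists2 z, z \in Z & x = subq_class Z B z.
Proof. by exists (subq_repr Z B x); rewrite ?subq_repr_mem ?subq_reprK. Qed.

Lemma subq_class_sub Z B z : z \in Z ->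
  z - subq_repr Z B (subq_class Z B z) \in B.
Proof.
move=> zZ; rewrite subq_reprE val_subq_class.
have zZB : z \in (Z + B)%VS by rewrite (subvP (addvSl Z B)).
by rewrite -{1}(addv_pi1_pi2 zZB) addrC addKr memv_pi2.
Qed.

Lemma subq_class_eq0 Z B z : (B <= Z)%VS -> z \in Z ->
  (subq_class Z B z == 0) = (z \in B).
Proof.
move=> BZ zZ; apply/eqP/idP => [z0|zB].
  by have := subq_class_sub B zZ; rewrite z0 linear0 subr0.
have h := rpredB zB (subq_class_sub B zZ).
rewrite opprB addrC subrK in h.
have: subq_repr Z B (subq_class Z B z) \in (B :&: (Z :\: B))%VS.
  by rewrite memv_cap h subq_reprE subvsP.
rewrite capvC capv_diff memv0 => /eqP h0.
by rewrite -(subq_reprK (subq_class Z B z)) h0 linear0.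
Qed.

Lemma dim_subq Z B : (B <= Z)%VS -> \dim {: subq Z B} = (\dim Z - \dim B)%N.
Proof.
move=> BZ; rewrite dimvf; have := dimv_cap_compl Z B; rewrite (capv_idPr BZ) => <-.
by rewrite addKn.
Qed.

End Subquotient.

(* The map Z1 / B1 -> Z2 / B2 induced by f, when f maps Z1 to Z2 and B1 to B2 *)
Definition subq_map (F : fieldType) (vT wT : vectType F) (Z1 B1 : {vspace vT})
    (Z2 B2 : {vspace wT}) (f : 'Hom(vT, wT)) : 'Hom(subq Z1 B1, subq Z2 B2) :=
  (subq_class Z2 B2 \o f \o subq_repr Z1 B1)%VF.

Lemma subq_map_class (F : fieldType) (vT wT : vectType F)
    (Z1 B1 : {vspace vT}) (Z2 B2 : {vspace wT}) (f : 'Hom(vT, wT)) z :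
    (f @: B1 <= B2)%VS -> (f @: Z1 <= Z2)%VS -> (B2 <= Z2)%VS -> z \in Z1 ->
  subq_map Z1 B1 Z2 B2 f (subq_class Z1 B1 z) = subq_class Z2 B2 (f z).
Proof.
move=> fB fZ BZ zZ; apply/eqP; rewrite 2!comp_lfunE.
rewrite eq_sym -subr_eq0 -!linearB /=.
have h : f (z - subq_repr Z1 B1 (subq_class Z1 B1 z)) \in B2.
  by apply: (subvP fB); rewrite memv_img ?subq_class_sub.
by rewrite subq_class_eq0 // (subvP BZ).
Qed.

(* N^n-graded S-modules, S = F[x_1, ..., x_n], with finite-dimensional        *)
(* homogeneous components. For u <= v, [gmap u v] is multiplication by the    *)
(* monomial x^(v - u); it is irrelevant when u <= v fails.                    *)

Section GradedModules.
Variables (F : fieldType) (n : nat).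

Record gmod := GMod {
  gcomp :> 'X_{1..n} -> vectType F;
  gmap : forall u v, 'Hom(gcomp u, gcomp v);
  gmap_id : forall u x, gmap u u x = x;
  gmap_comp : forall u v w x, (u <= v)%MM -> (v <= w)%MM ->
    gmap v w (gmap u v x) = gmap u w x
}.
Arguments gmap : clear implicits.

Record gmorph (M N : gmod) := GMorph {
  gfun :> forall u, 'Hom(M u, N u);
  gfun_nat : forall u v x, (u <= v)%MM ->
    gfun v (gmap M u v x) = gmap N u v (gfun u x)
}.

(* Freeness: [g v] lists the basis elements of degree v, and the component of *)
(* degree u has as basis the multiples x^(u - v) x with v <= u and x in g v.  *)
(* Infinitely many generators are allowed, but only finitely many in each     *)
(* degree.                                                                    *)
Definition gfree (P : gmod) : Prop :=
  exists g : forall v, seq (P v), forall u,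
    basis_of fullv [seq gmap P v u x | v <- below u, x <- g v].

Record free_resolution (M : gmod) := FreeResolution {
  res :> nat -> gmod;
  res_d : forall i, gmorph (res i.+1) (res i);
  res_aug : gmorph (res 0) M;
  res_free : forall i, gfree (res i);
  res_aug_surj : forall u, limg (res_aug u) = fullv;
  res_exact0 : forall u, limg (res_d 0 u) = lker (res_aug u);
  res_exactS : forall i u, limg (res_d i.+1 u) = lker (res_d i u)
}.

(* M (x)_S F with F = S / m, m = <x_1, ..., x_n>, is M / mM. *)
Definition maxm (M : gmod) (u : 'X_{1..n}) : {vspace M u} :=
  (\sum_(j < n | (0 < u j)%N) limg (gmap M (u - U_(j)) u))%VS.

Definition tensF (M : gmod) (u : 'X_{1..n}) : vectType F :=
  subq fullv (maxm M u).

Definition tensF_map (M N : gmod) (f : gmorph M N) u :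
    'Hom(tensF M u, tensF N u) :=
  subq_map fullv (maxm M u) fullv (maxm N u) (f u).

Definition tor_cycles (M : gmod) (P : free_resolution M) (i : nat) u :
    {vspace tensF (P i) u} :=
  match i with
  | 0 => fullv
  | j.+1 => lker (tensF_map (res_d P j) u)
  end.

Definition tor_boundaries (M : gmod) (P : free_resolution M) (i : nat) u :
    {vspace tensF (P i) u} :=
  limg (tensF_map (res_d P i) u).

Definition tor_of (M : gmod) (P : free_resolution M) (i : nat) u : vectType F :=
  subq (tor_cycles P i u) (tor_boundaries P i u).

(* Existence of free resolutions: the free module on a basis of every M v     *)
(* covers M, and one iterates with the kernel of this cover.                  *)

Section Cover.
Variable M : gmod.

Definition cov_gens (v : 'X_{1..n}) : seq ('X_{1..n} * nat) :=
  [seq (v, k) | k <- iota 0 (\dim {: M v})].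

Definition cov_idx (u : 'X_{1..n}) : seq ('X_{1..n} * nat) :=
  [seq p | v <- below u, p <- cov_gens v].

Lemma mem_cov_gens v p :
  (p \in cov_gens v) = (p.1 == v) && (p.2 < \dim {: M p.1})%N.
Proof.
case: p => w k /=; apply/mapP/andP => [[l + [-> ->]]|[/eqP-> kd]].
  by rewrite mem_iota => /andP[_ ->]; rewrite eqxx.
by exists k; rewrite ?mem_iota.
Qed.

Lemma mem_cov_idx u p :
  (p \in cov_idx u) = (p.1 <= u)%MM && (p.2 < \dim {: M p.1})%N.
Proof.
apply/allpairsPdep/idP => [[v [q [vu qv ->]]]|/andP[pu pd]].
  by move: qv vu; rewrite mem_cov_gens mem_below => /andP[/eqP-> ->] ->.
by exists p.1, p; rewrite mem_below pu mem_cov_gens eqxx pd.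
Qed.

Lemma cov_idx_uniq u : uniq (cov_idx u).
Proof.
apply: allpairs_uniq_dep => [|v _|[v p] [w q] /=]; first exact: below_uniq.
  by rewrite map_inj_uniq ?iota_uniq // => k l [].
move=> /allpairsPdep[v' [p' [_ pv [? ?]]]] /allpairsPdep[w' [q' [_ qw [? ?]]]].
move=> /= pq; subst; move: pv qw; rewrite !mem_cov_gens.
by move=> /andP[/eqP <- _] /andP[/eqP <- _].
Qed.

Definition cov_sp u : vectType F := {ffun seq_sub (cov_idx u) -> F^o}.

Definition cov_get u (p : 'X_{1..n} * nat) (f : cov_sp u) : F^o :=
  if insub p is Some p' then f p' else 0.

Fact cov_get_linear u p : linear (@cov_get u p).
Proof.
move=> a f g; rewrite /cov_get; case: insubP => [p' _ _|_].
  by rewrite !ffunE.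
by rewrite scaler0 addr0.
Qed.

HB.instance Definition _ u p :=
  GRing.isLinear.Build F (cov_sp u) F^o _ (@cov_get u p)
    (@cov_get_linear u p).

Lemma cov_getE u (f : cov_sp u) (p : seq_sub (cov_idx u)) :
  cov_get (val p) f = f p.
Proof. by rewrite /cov_get valK. Qed.

Lemma cov_get0 u (f : cov_sp u) p : p \notin cov_idx u -> cov_get p f = 0.
Proof. by move=> pu; rewrite /cov_get insubN. Qed.

Definition cov_map_fun u v (f : cov_sp u) : cov_sp v :=
  [ffun p => cov_get (val p) f].

Fact cov_map_linear u v : linear (@cov_map_fun u v).
Proof.
by move=> a f g; apply/ffunP => p; rewrite !ffunE cov_get_linear.
Qed.

HB.instance Definition _ u v :=
  GRing.isLinear.Build F (cov_sp u) (cov_sp v) _ (@cov_map_fun u v)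
    (@cov_map_linear u v).

Definition cov_map u v : 'Hom(cov_sp u, cov_sp v) := linfun (@cov_map_fun u v).

Lemma cov_mapE u v f p : p \in cov_idx v ->
  cov_get p (cov_map u v f) = cov_get p f.
Proof.
by move=> pv; rewrite -[p]/(val (SeqSub pv)) cov_getE lfunE ffunE.
Qed.

Lemma cov_spP u (f g : cov_sp u) :
  (forall p, p \in cov_idx u -> cov_get p f = cov_get p g) -> f = g.
Proof.
by move=> fg; apply/ffunP => p; rewrite -!cov_getE fg // (valP p).
Qed.

Lemma cov_map_id u x : cov_map u u x = x.
Proof. by apply: cov_spP => p pu; rewrite cov_mapE. Qed.

Lemma cov_map_comp u v w x : (u <= v)%MM -> (v <= w)%MM ->
  cov_map v w (cov_map u v x) = cov_map u w x.
Proof.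
move=> uv vw; apply: cov_spP => p pw; rewrite cov_mapE // [RHS]cov_mapE //.
have [pv|pv] := boolP (p \in cov_idx v); first by rewrite cov_mapE.
rewrite !cov_get0 //; apply: contra pv; rewrite !mem_cov_idx => /andP[pu ->].
by rewrite (lem_transi pu uv).
Qed.

Definition cov : gmod := GMod cov_map_id cov_map_comp.

Definition cov_delta u (p : 'X_{1..n} * nat) : cov_sp u :=
  [ffun q => (val q == p)%:R].

Lemma cov_get_delta u p q : q \in cov_idx u ->
  cov_get q (cov_delta u p) = (q == p)%:R.
Proof.
by move=> qu; rewrite -[q]/(val (SeqSub qu)) cov_getE ffunE.
Qed.

Lemma cov_map_delta u v p : p \in cov_idx u ->
  (u <= v)%MM -> cov_map u v (cov_delta u p) = cov_delta v p.
Proof.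
move=> pu uv; apply: cov_spP => q qv.
rewrite [RHS]cov_get_delta // cov_mapE //.
have [qu|qu] := boolP (q \in cov_idx u); first by rewrite cov_get_delta.
rewrite cov_get0 //; have [qp|_] := eqVneq q p; last by rewrite mulr0n.
by rewrite qp pu in qu.
Qed.

Lemma cov_delta_sum u (f : cov_sp u) :
  f = \sum_(p <- cov_idx u) cov_get p f *: cov_delta u p.
Proof.
apply: cov_spP => q qu.
rewrite linear_sum /=.
rewrite (bigD1_seq q) ?cov_idx_uniq //= big1 => [|p /negPf pq].
  rewrite linearZ /=.
  by rewrite cov_get_delta // eqxx addr0 [_ *: _]mulr1.
rewrite linearZ /=.
by rewrite cov_get_delta // eq_sym pq scaler0.
Qed.

Lemma cov_free : gfree cov.
Proof.
exists (fun v => [seq cov_delta v p | p <- cov_gens v]) => u.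
have -> : [seq gmap cov v u x | v <- below u,
              x <- [seq cov_delta v p | p <- cov_gens v]]
          = [seq cov_delta u p | p <- cov_idx u].
  rewrite /cov_idx map_allpairs allpairs_mapr.
  apply/eq_in_allpairs_dep => v; rewrite mem_below => vu p.
  rewrite mem_cov_gens => /andP[/eqP pv pd]; apply: cov_map_delta => //.
  by rewrite mem_cov_idx pd pv andbT; apply/mnm_lepP.
rewrite basisEdim; apply/andP; split.
  apply/subvP => f _; rewrite (cov_delta_sum f) big_seq memv_suml // => p pu.
  by rewrite memvZ // memv_span // map_f.
by rewrite dimvf /dim /= muln1 size_map card_seq_sub ?cov_idx_uniq.
Qed.

Definition aug_fun u (f : cov_sp u) : M u :=
  \sum_(p <- cov_idx u)
     (cov_get p f : F) *: gmap M p.1 u (vbasis fullv)`_p.2.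

Fact aug_linear u : linear (@aug_fun u).
Proof.
move=> a f g; rewrite /aug_fun scaler_sumr -big_split; apply: eq_bigr => p _.
by rewrite cov_get_linear scalerDl scalerA.
Qed.

HB.instance Definition _ u :=
  GRing.isLinear.Build F (cov_sp u) (M u) _ (@aug_fun u) (@aug_linear u).

Fact aug_nat u v (x : cov u) : (u <= v)%MM ->
  linfun (@aug_fun v) (gmap cov u v x) = gmap M u v (linfun (@aug_fun u) x).
Proof.
move=> uv; rewrite -[gmap cov u v x]/(cov_map u v x) [LHS]lfunE [in RHS]lfunE.
rewrite /= /aug_fun linear_sum /=.
rewrite (bigID [pred p | p \in cov_idx u]) /= addrC big1_seq ?add0r.
  rewrite -big_filter (perm_big (cov_idx u)) => [|].
    rewrite big_seq [RHS]big_seq; apply: eq_bigr => p.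
    rewrite mem_cov_idx => /andP[pu pd]; rewrite linearZ /= gmap_comp //.
    by rewrite cov_mapE // mem_cov_idx pd (lem_transi pu uv).
  apply: uniq_perm; rewrite ?filter_uniq ?cov_idx_uniq // => p.
  rewrite mem_filter; apply: andb_idr; rewrite !mem_cov_idx => /andP[pu ->].
  by rewrite (lem_transi pu uv).
by move=> p /andP[pu pv]; rewrite cov_mapE // cov_get0 // scale0r.
Qed.

Definition aug : gmorph cov M := GMorph aug_nat.

Lemma aug_delta u p : p \in cov_idx u ->
  aug u (cov_delta u p) = gmap M p.1 u (vbasis fullv)`_p.2.
Proof.
move=> pu; rewrite lfunE /= /aug_fun (bigD1_seq p) ?cov_idx_uniq //=.
rewrite cov_get_delta // eqxx scale1r big1_seq ?addr0 // => q /andP[qp qu].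
by rewrite cov_get_delta // (negPf qp) scale0r.
Qed.

Lemma aug_surj u : limg (aug u) = fullv.
Proof.
apply/eqP; rewrite eqEsubv subvf; apply/subvP => x _.
rewrite (coord_vbasis (memvf x)); apply: memv_suml => k _; apply: memvZ.
have ku : (u, val k) \in cov_idx u.
  by rewrite mem_cov_idx ltn_ord andbT; apply/mnm_lepP.
by rewrite -[_`_k](gmap_id (g := M)) -(aug_delta ku) memv_img ?memvf.
Qed.

End Cover.

Section Kernel.
Variables (M N : gmod) (f : gmorph M N).

Definition ker_sp u : vectType F := subvs_of (lker (f u)).

Definition ker_map u v : 'Hom(ker_sp u, ker_sp v) :=
  (linfun (vsproj (lker (f v))) \o gmap M u v \o linfun vsval)%VF.

Lemma ker_mapE u v (x : ker_sp u) : (u <= v)%MM ->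
  vsval (ker_map u v x) = gmap M u v (vsval x).
Proof.
move=> uv; rewrite !comp_lfunE !lfunE /= vsprojK // memv_ker gfun_nat //.
by have := subvsP x; rewrite memv_ker => /eqP ->; rewrite linear0.
Qed.

Lemma ker_map_id u x : ker_map u u x = x.
Proof.
apply: subvs_inj; apply: etrans (ker_mapE x _) (gmap_id _).
exact/mnm_lepP.
Qed.

Lemma ker_map_comp u v w x : (u <= v)%MM -> (v <= w)%MM ->
  ker_map v w (ker_map u v x) = ker_map u w x.
Proof.
move=> uv vw; apply: subvs_inj; apply: etrans (ker_mapE _ vw) _.
apply: etrans _ (esym (ker_mapE x (lem_transi uv vw))).
by rewrite ker_mapE // gmap_comp.
Qed.

Definition gker : gmod :=
  GMod ker_map_id ker_map_comp.

Definition ker_val u : 'Hom(gker u, M u) := linfun vsval.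

Fact ker_incl_nat u v (x : gker u) : (u <= v)%MM ->
  ker_val v (gmap gker u v x) = gmap M u v (ker_val u x).
Proof. by move=> uv; rewrite lfunE [in RHS]lfunE; apply: ker_mapE. Qed.

Definition ker_incl : gmorph gker M := GMorph ker_incl_nat.

End Kernel.

Fact gcomp_morph_nat (M N Q : gmod) (g : gmorph N Q) (f : gmorph M N) u v x :
  (u <= v)%MM ->
  (g v \o f v)%VF (gmap M u v x) = gmap Q u v ((g u \o f u)%VF x).
Proof. by move=> uv; rewrite !comp_lfunE !gfun_nat. Qed.

Definition gcomp_morph (M N Q : gmod) (g : gmorph N Q) (f : gmorph M N) :
  gmorph M Q := GMorph (gcomp_morph_nat g f).

Lemma some_free_resolution (M : gmod) : free_resolution M.
Proof.
pose K := fix K i := if i is j.+1 then gker (aug (K j)) else M.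
pose d i : gmorph (cov (K i.+1)) (cov (K i)) :=
  gcomp_morph (ker_incl (aug (K i))) (aug (K i.+1)).
have imd i u : limg (d i u) = lker (aug (K i) u).
  rewrite limg_comp aug_surj; apply/vspaceP => x.
  apply/memv_imgP/idP => [[y _ ->]|xk]; first by rewrite lfunE /= subvsP.
  by exists (vsproj _ x); rewrite ?memvf // lfunE /= vsprojK.
have kerd i u : lker (d i u) = lker (aug (K i.+1) u).
  apply/vspaceP => x; rewrite !memv_ker comp_lfunE lfunE /=.
  by rewrite -(inj_eq subvs_inj) linear0.
apply: (@FreeResolution M (fun i => cov (K i)) d (aug M)) => [i|u|u|i u].
- exact: cov_free.
- exact: aug_surj.
- exact: imd.
- by rewrite imd kerd.
Qed.

(* Tor_i^S(M, F)^u; it does not depend on the free resolution. *)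
Definition tor (M : gmod) (i : nat) (u : 'X_{1..n}) : vectType F :=
  tor_of (some_free_resolution M) i u.

Definition betti (M : gmod) (i : nat) (u : 'X_{1..n}) : nat :=
  \dim {: tor M i u}.

End GradedModules.

Record cellComplex (F : fieldType) := CellComplex {
  cell :> finType;
  cdim : cell -> nat;
  kappa : cell -> cell -> F;
  kappa_dim : forall t s, kappa t s != 0 -> cdim t = (cdim s).+1;
  kappa_sq : forall t s, \sum_r kappa t r * kappa r s = 0
}.

Section Homology.
Variables (F : fieldType) (X : cellComplex F).
Implicit Types (s t : X) (A B : {set X}).

(* The face order is the reflexive and transitive closure of s < t whenever   *)
(* kappa t s != 0.                                                            *)
Definition face_le : rel X := connect (fun s t => kappa t s != 0).

Definition subcomplex A : Prop :=
  forall s t, t \in A -> face_le s t -> s \in A.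

(* The sum of all C_q(X). *)
Definition chains : vectType F := {ffun X -> F^o}.

Definition cell_chain s : chains := [ffun t => (t == s)%:R].

Definition bdry_fun (c : chains) : chains :=
  [ffun s => \sum_t c t * kappa t s].

Fact bdry_linear : linear bdry_fun.
Proof.
move=> a c d; apply/ffunP => s; rewrite !ffunE scaler_sumr -big_split.
by apply: eq_bigr => t _; rewrite !ffunE mulrDl -mulrA.
Qed.

HB.instance Definition _ :=
  GRing.isLinear.Build F chains chains _ bdry_fun bdry_linear.

Definition bdry : 'End(chains) := linfun bdry_fun.

Lemma bdry_cell t : bdry (cell_chain t) = \sum_s kappa t s *: cell_chain s.
Proof.
apply/ffunP => r; rewrite lfunE !ffunE sum_ffunE (bigD1 t) //= [RHS](bigD1 r) //=.
rewrite !ffunE !eqxx mul1r [_ *: _]mulr1; congr (_ + _).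
rewrite !big1 // => s /negPf sr; first by rewrite !ffunE eq_sym sr scaler0.
by rewrite ffunE sr mul0r.
Qed.

(* For a subcomplex A, the chain group C_q(A) inside C_q(X). *)
Definition Cq (q : nat) A : {vspace chains} :=
  (\sum_(s in A | cdim s == q) <[cell_chain s]>)%VS.
Definition Zq q A : {vspace chains} := (Cq q A :&: lker bdry)%VS.
Definition Bq q A : {vspace chains} := (bdry @: Cq q.+1 A)%VS.

Definition homology q A : vectType F := subq (Zq q A) (Bq q A).

Definition homology_map q A B : 'Hom(homology q A, homology q B) :=
  subq_map (Zq q A) (Bq q A) (Zq q B) (Bq q B) \1%VF.

Lemma bdry_bdry c : bdry (bdry c) = 0.
Proof.
apply/ffunP => s; rewrite !lfunE !ffunE.
under eq_bigr => t _ do rewrite ffunE mulr_suml.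
rewrite exchange_big big1 // => r _ /=.
transitivity ((c r : F) * \sum_t kappa r t * kappa t s).
  by rewrite mulr_sumr; apply: eq_bigr => t _; rewrite mulrA.
by rewrite kappa_sq mulr0.
Qed.

Lemma Bq_sub_Zq q A : subcomplex A -> (Bq q A <= Zq q A)%VS.
Proof.
move=> subA; apply/subvP => _ /memv_imgP[c cA ->].
rewrite memv_cap memv_ker bdry_bdry eqxx andbT.
have /subvP : (bdry @: Cq q.+1 A <= Cq q A)%VS; last by apply; apply: memv_img.
rewrite limg_sum; apply/subv_sumP => t /andP[tA /eqP tq].
rewrite limg_line -memvE bdry_cell memv_suml // => s _.
have [->|ks] := eqVneq (kappa t s) 0; first by rewrite scale0r mem0v.
have st : face_le s t by apply: connect1.
rewrite memvZ // memvE (sumv_sup s) // (subA s t) //=.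
by rewrite -eqSS -(kappa_dim ks) tq.
Qed.

Lemma Cq_mono q A B : A \subset B -> (Cq q A <= Cq q B)%VS.
Proof.
move=> /subsetP AB; apply/subv_sumP => s /andP[sA sq].
by rewrite (sumv_sup s) // AB.
Qed.

Lemma homology_map_id q A x : homology_map q A A x = x.
Proof.
by rewrite /homology_map /subq_map 2!comp_lfunE id_lfunE subq_reprK.
Qed.

Lemma homology_map_comp q A B C x :
    subcomplex A -> subcomplex B -> subcomplex C ->
    A \subset B -> B \subset C ->
  homology_map q B C (homology_map q A B x) = homology_map q A C x.
Proof.
move=> sA sB sC AB BC; have AC := subset_trans AB BC.
have inclB A' B' : A' \subset B' -> (\1%VF @: Bq q A' <= Bq q B')%VS.
  by move=> AB'; rewrite lim1g limgS ?Cq_mono.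
have inclZ A' B' : A' \subset B' -> (\1%VF @: Zq q A' <= Zq q B')%VS.
  by move=> AB'; rewrite lim1g capvS ?Cq_mono.
have [z zA ->] := subq_class_surj x.
have zB : z \in Zq q B by apply: (subvP (inclZ _ _ AB)); rewrite lim1g.
by rewrite /homology_map !subq_map_class ?id_lfunE ?inclB ?inclZ ?Bq_sub_Zq //.
Qed.

End Homology.

Record filtration (F : fieldType) (n : nat) (X : cellComplex F) := Filtration {
  fil :> 'X_{1..n} -> {set X};
  fil_sub : forall u, subcomplex (fil u);
  fil_mono : forall u v, (u <= v)%MM -> fil u \subset fil v
}.

Section Filtrations.
Variables (F : fieldType) (n : nat) (X : cellComplex F) (Xf : filtration n X).

Definition exhaustive : Prop := forall s : X, exists u, s \in Xf u.

Definition one_critical : Prop :=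
  exists h : X -> 'X_{1..n},
    (forall s t, face_le s t -> (h s <= h t)%MM) /\
    (forall u, Xf u = [set s | (h s <= u)%MM]).

(* u - e_j lies outside N^n, so that X^(u - e_j) is empty, when u j = 0. *)
Definition entrance_grade (s : X) (u : 'X_{1..n}) : Prop :=
  s \in Xf u /\ forall j : 'I_n, (0 < u j)%N -> s \notin Xf (u - U_(j))%MM.

Definition grades (q : nat) (u : 'X_{1..n}) : Prop :=
  exists s : X, cdim s = q /\ entrance_grade s u.

Fact fil_homology_comp q u v w x : (u <= v)%MM -> (v <= w)%MM ->
  homology_map q (Xf v) (Xf w) (homology_map q (Xf u) (Xf v) x) =
  homology_map q (Xf u) (Xf w) x.
Proof.
by move=> uv vw; apply: homology_map_comp; by [apply: fil_sub|apply: fil_mono].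
Qed.

(* V_q, the direct sum of the H_q(X^u) *)
Definition fil_homology (q : nat) : gmod F n :=
  GMod (fun u x => homology_map_id (q := q) (A := Xf u) x)
       (fil_homology_comp (q := q)).

(* xi q i is the table xi_i^q. *)
Definition xi (q i : nat) : 'X_{1..n} -> nat := betti (fil_homology q) i.

End Filtrations.

(* Main.v *)
(** The graded pieces of Tor are detected by Koszul complexes. Write
    0 -> B_q -> Z_q -> V_q -> 0 for the graded modules of cycles, boundaries
    and homology. If u is not a join of grades of q-cells, then either no q-cell
    lives below u, or some coordinate u_j is not reached by the join of the
    grades below u, and then C_q(X^(v - e_j)) = C_q(X^v) for all v <= u with
    v_j = u_j. In the latter case multiplication by x_j is bijective on the
    corresponding pieces of Z_q, so the Koszul complex of Z_q, a mapping cone of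
    x_j, is acyclic in degree u; likewise for B_q with (q+1)-cells. The long
    exact sequence gives the statement on all tables and the one on xi_0. For
    xi_n, only B_q is needed: x_j is then injective on the relevant pieces of
    V_q, which kills the top Koszul homology. *)
Require Import Defs.
From HB Require Import structures.
From mathcomp Require Import all_boot all_order all_algebra.
From mathcomp.multinomials Require Import mpoly.

Set Implicit Arguments.
Unset Strict Implicit.
Unset Printing Implicit Defensive.

Import GRing.Theory.
Local Open Scope ring_scope.

(** * Coordinatewise comparison of exponent vectors *)

Lemma lem_leq n (u v : 'X_{1..n}) : (u <= v)%MM -> forall j, (u j <= v j)%N.
Proof. by move/mnm_lepP. Qed.

Lemma lem_subl n (u v : 'X_{1..n}) : (u - v <= u)%MM.
Proof. by apply/mnm_lepP => k; rewrite mnmBE leq_subr. Qed.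

Lemma lem_sub2r n (w u v : 'X_{1..n}) : (u <= v)%MM -> (u - w <= v - w)%MM.
Proof. by move=> /mnm_lepP le; apply/mnm_lepP => k; rewrite !mnmBE leq_sub2r. Qed.

Local Hint Resolve lem_subl lem_sub2r lepm_refl : core.

(** * Koszul complexes as iterated mapping cones *)

Section Koszul.
Variables (F : fieldType) (n : nat).
Implicit Types (M N : gmod F n) (js : seq 'I_n) (u v w : 'X_{1..n}).

(* The total object of the Koszul complex of M on the variables x_j, j in js,
   in multidegree u: the mapping cone of x_j on the complex for the remaining
   variables. The homological degree is not part of the type but is tracked by
   [kdeg] below. When u j = 0 the truncated u - U_(j) is junk, and [kdeg]
   forces the second component to vanish. *)
Fixpoint kos M js u : zmodType :=
  if js is j :: js' then (kos M js' u * kos M js' (u - U_(j))%MM)%type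
  else M u.

Arguments kos : simpl never.

Fixpoint kmul M js u v : kos M js u -> kos M js v :=
  match js with
  | [::] => gmap M u v
  | j :: js' => fun x => (kmul v x.1, kmul (v - U_(j))%MM x.2)
  end.

(** The cone differential: [kmul u] on the second component is multiplication by x_j, and the sign
    makes the cross terms cancel in [kd_kd]. *)
Fixpoint kd M js u : kos M js u -> kos M js u :=
  match js with
  | [::] => fun=> 0
  | j :: js' => fun x => (kd x.1 + kmul u x.2, - kd x.2)
  end.

Fixpoint kdeg M js i u : kos M js u -> Prop :=
  match js with
  | [::] => fun x => (0 < i)%N -> x = 0
  | j :: js' => fun x => kdeg i x.1 /\
      (if (0 < i)%N && (0 < u j)%N then kdeg i.-1 x.2 else x.2 = 0)
  end.

Fixpoint kmap M N (f : gmorph M N) js u : kos M js u -> kos N js u :=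
  match js with
  | [::] => f u
  | j :: js' => fun x => (kmap f x.1, kmap f x.2)
  end.

Fact kmul_additive M js u v : zmod_morphism (@kmul M js u v).
Proof.
elim: js u v => [|j js IH] u v x y /=; first exact: linearB.
by rewrite IH IH.
Qed.

HB.instance Definition _ M js u v :=
  GRing.isZmodMorphism.Build _ _ (@kmul M js u v) (@kmul_additive M js u v).

Fact kd_additive M js u : zmod_morphism (@kd M js u).
Proof.
elim: js u => [|j js IH] u x y /=; first by rewrite subr0.
by rewrite !IH raddfB addrACA -opprD [- (_ - _)]opprD.
Qed.

HB.instance Definition _ M js u :=
  GRing.isZmodMorphism.Build _ _ (@kd M js u) (@kd_additive M js u).

Fact kmap_additive M N (f : gmorph M N) js u :
  zmod_morphism (@kmap M N f js u).
Proof.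
elim: js u => [|j js IH] u x y /=; first exact: linearB.
by rewrite IH IH.
Qed.

HB.instance Definition _ M N (f : gmorph M N) js u :=
  GRing.isZmodMorphism.Build _ _ (@kmap M N f js u)
    (@kmap_additive M N f js u).

Lemma kmul_comp M js u v w (x : kos M js u) :
  (u <= v)%MM -> (v <= w)%MM -> kmul w (kmul v x) = kmul w x.
Proof.
elim: js u v w x => [|j js IH] u v w x uv vw /=; first exact: gmap_comp.
by rewrite !IH ?lem_sub2r.
Qed.

Lemma kd_kmul M js u v (x : kos M js u) :
  (u <= v)%MM -> kd (kmul v x) = kmul v (kd x).
Proof.
elim: js u v x => [|j js IH] u v x uv /=; first by rewrite raddf0.
by rewrite !IH ?lem_sub2r // raddfD raddfN /= !kmul_comp ?lem_sub2r.
Qed.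

Lemma kd_kd M js u (x : kos M js u) : kd (kd x) = 0.
Proof.
elim: js u x => [|j js IH] u x //=.
rewrite !raddfD !raddfN /= !IH kd_kmul //.
by rewrite add0r subrr opprK.
Qed.

Lemma kdeg0 M js i u : kdeg i (0 : kos M js u).
Proof.
by elim: js i u => [|j js IH] i u //=; split; [apply: IH|case: ifP => _ //; apply: IH].
Qed.

Lemma kdegB M js i u (x y : kos M js u) : kdeg i x -> kdeg i y -> kdeg i (x - y).
Proof.
elim: js i u x y => [|j js IH] i u x y /=.
  by move=> hx hy i_gt0; rewrite hx ?hy ?subr0.
case=> x1 x2 [y1 y2]; split; first exact: IH.
by move: x2 y2; case: ifP => _; [apply: IH|move=> -> ->; rewrite subr0].
Qed.

Lemma kdegN M js i u (x : kos M js u) : kdeg i x -> kdeg i (- x).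
Proof. by move=> hx; rewrite -sub0r; apply: kdegB => //; apply: kdeg0. Qed.

Lemma kdegD M js i u (x y : kos M js u) : kdeg i x -> kdeg i y -> kdeg i (x + y).
Proof. by move=> hx hy; rewrite -[y]opprK; apply/kdegB/kdegN. Qed.

Lemma kdeg_kmul M js i u v (x : kos M js u) :
  (u <= v)%MM -> kdeg i x -> kdeg i (kmul v x).
Proof.
elim: js i u v x => [|j js IH] i u v x uv /=.
  by move=> hx i_gt0; rewrite hx ?linear0.
case=> x1 x2; split; first exact: IH.
move: x2; case: (0 < i)%N => /=; last by move=> ->; rewrite raddf0.
case: ifP => [uj x2|_ ->].
  have -> : (0 < v j)%N by exact: leq_trans uj (lem_leq uv j).
  by apply: IH; rewrite ?lem_sub2r.
by rewrite raddf0; case: ifP => // _; apply: kdeg0.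
Qed.

Lemma kd_kdeg0 M js u (x : kos M js u) : kdeg 0 x -> kd x = 0.
Proof.
elim: js u x => [|j js IH] u x //= [x1 x2].
by rewrite IH // x2 !raddf0 addr0.
Qed.

Lemma kdeg_kd M js i u (x : kos M js u) : kdeg i.+1 x -> kdeg i (kd x).
Proof.
elim: js i u x => [|j js IH] i u x //= [x1].
case: ifP => uj x2; split.
- by apply: kdegD; [apply: IH|apply: kdeg_kmul].
- case: i x1 x2 => [|i] x1 x2 /=; first by rewrite kd_kdeg0 ?oppr0.
  by apply/kdegN/IH.
- by rewrite x2 raddf0 addr0; apply: IH.
- by rewrite x2 raddf0 oppr0; case: ifP => // _; apply: kdeg0.
Qed.

Lemma kdeg_size M js i u (x : kos M js u) : (size js < i)%N -> kdeg i x -> x = 0.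
Proof.
move: x; elim: js i u => [|j js IH] i u /=; first by move=> x lt; apply.
case: i => // i [x1 x2] /= lt [/IH -> //]; last exact: ltnW.
by case: ifP => _ x2d; congr pair; first exact: IH x2d.
Qed.

Lemma kmap_kmul M N (f : gmorph M N) js u v (x : kos M js u) :
  (u <= v)%MM -> kmap f (kmul v x) = kmul v (kmap f x).
Proof.
elim: js u v x => [|j js IH] u v x uv /=; first exact: gfun_nat.
by rewrite !IH ?lem_sub2r.
Qed.

Lemma kmap_kd M N (f : gmorph M N) js u (x : kos M js u) :
  kmap f (kd x) = kd (kmap f x).
Proof.
elim: js u x => [|j js IH] u x /=; first by rewrite raddf0.
by rewrite raddfD raddfN /= !IH kmap_kmul.
Qed.

Lemma kdeg_kmap M N (f : gmorph M N) js i u (x : kos M js u) :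
  kdeg i x -> kdeg i (kmap f x).
Proof.
elim: js i u x => [|j js IH] i u x /=.
  by move=> hx i_gt0; rewrite hx ?linear0.
case=> x1 x2; split; first exact: IH.
by move: x2; case: ifP => _; [apply: IH|move=> ->; rewrite raddf0].
Qed.

(** Vanishing of the i-th Koszul homology in multidegree u; when [js] lists every variable once,
    this amounts to Tor_i(M, F)^u = 0. *)
Definition acyclic M js i u : Prop :=
  forall x : kos M js u, kdeg i x -> kd x = 0 ->
  exists2 y : kos M js u, kdeg i.+1 y & x = kd y.

End Koszul.

(** * The long exact sequence of Koszul homology for 0 -> ker f -> M -> N -> 0 *)

Section KoszulExact.
Variables (F : fieldType) (n : nat) (M N : gmod F n) (f : gmorph M N).
Implicit Types (js : seq 'I_n) (u v w : 'X_{1..n}).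

Lemma limg_ker_incl u : limg (ker_incl f u) = lker (f u).
Proof.
apply/vspaceP => x; apply/memv_imgP/idP => [[y _ ->]|xk].
  by rewrite lfunE subvsP.
by exists (vsproj (lker (f u)) x); rewrite ?memvf // lfunE /= vsprojK.
Qed.

Lemma kmap_incl_inj js u : injective (@kmap F n _ _ (ker_incl f) js u).
Proof.
elim: js u => [|j js IH] u /= x y; first by rewrite !lfunE; apply: subvs_inj.
by case: x y => [x1 x2] [y1 y2] /= [/IH -> /IH ->].
Qed.

Lemma kmap_incl_kmap js u x : kmap f (@kmap F n _ _ (ker_incl f) js u x) = 0.
Proof.
elim: js u x => [|j js IH] u x /=; last by rewrite !IH.
by rewrite lfunE; apply/eqP; rewrite -memv_ker; apply: subvsP.
Qed.

(** Together with [kmap_incl_inj] and [kmap_surj], this makes the Koszul complexes a short exact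
    sequence; preimages must keep the homological degree. *)
Lemma kmap_ker js i u (x : kos M js u) : kdeg i x -> kmap f x = 0 ->
  exists2 a, kdeg i a & x = kmap (ker_incl f) a.
Proof.
elim: js i u x => [|j js IH] i u x /=.
  move=> hx /eqP; rewrite -memv_ker => kx.
  exists (vsproj (lker (f u)) x); last by rewrite lfunE /= vsprojK.
  by move=> /hx ->; rewrite linear0.
case: x => [x1 x2] /= [d1 d2] [z1 z2].
have [a1 da1 ->] := IH _ _ _ d1 z1.
move: d2; case: ifP => [c d2|c ->].
  have [a2 da2 ->] := IH _ _ _ d2 z2.
  by exists (a1, a2); rewrite //= c.
by exists (a1, 0); rewrite /= ?c ?raddf0.
Qed.

Hypothesis f_surj : forall u, limg (f u) = fullv.

Lemma kmap_surj js i u (y : kos N js u) : kdeg i y ->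
  exists2 x, kdeg i x & y = kmap f x.
Proof.
elim: js i u y => [|j js IH] i u y /=.
  (* The lift must have degree i as well: 0 lifts to 0, and a nonzero y forces i = 0, where [kdeg]
     imposes nothing. *)
  move=> d; have [->|y0] := eqVneq y 0; first by exists 0; rewrite ?linear0.
  have /memv_imgP[x _ ->] : y \in limg (f u) by rewrite f_surj memvf.
  by exists x => // /d /eqP; rewrite (negPf y0).
case: y => [y1 y2] /= [/IH[a1 da1 ->]].
case: ifP => [c /IH[a2 da2 ->]|c ->]; first by exists (a1, a2); rewrite //= c.
by exists (a1, 0); rewrite /= ?c ?raddf0.
Qed.

(** The chase behind injectivity of H_i(ker f) -> H_i(M): [kmap f y] is a cycle, hence the boundary
    of some z, and subtracting from y the boundary of a lift of z moves y into the kernel. *)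
Lemma boundary_ker js i u (x : kos (gker f) js u) y : acyclic N js i.+1 u ->
  kdeg i x -> kdeg i.+1 y -> kmap (ker_incl f) x = kd y ->
  exists2 z : kos (gker f) js u, kdeg i.+1 z & x = kd z.
Proof.
move=> acN dx dy xy.
have [|z dz fyz] := acN (kmap f y) (kdeg_kmap f dy).
  by rewrite -kmap_kd -xy kmap_incl_kmap.
have [z' dz' def_z] := kmap_surj dz.
have [||a da ya] := @kmap_ker js i.+1 u (y - kd z').
- by apply: kdegB => //; apply: kdeg_kd.
- by rewrite raddfB /= kmap_kd fyz def_z subrr.
exists a => //; apply: (@kmap_incl_inj js u).
by rewrite kmap_kd -ya raddfB /= kd_kd subr0.
Qed.

(** Exactness of H_{i+1}(N) -> H_i(ker f) -> H_i(M). *)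
Lemma acyclic_ker js i u : acyclic N js i.+1 u -> acyclic M js i u ->
  acyclic (gker f) js i u.
Proof.
move=> acN acM x dx x0.
have [|y dy xy] := acM _ (kdeg_kmap (ker_incl f) dx).
  by rewrite -kmap_kd x0 raddf0.
exact: boundary_ker xy.
Qed.

(** Exactness of H_i(M) -> H_i(N) -> H_{i-1}(ker f). The equation [i = k.+1] makes the condition on
    the kernel vacuous for i = 0. *)
Lemma acyclic_quot js i u : acyclic M js i u ->
  (forall k, i = k.+1 -> acyclic (gker f) js k u) ->
  acyclic N js i u.
Proof.
move=> acM acA c dc c0; have [b db def_c] := kmap_surj dc.
suff [b' db' [fb' b'0]]: exists2 b', kdeg i b' & kmap f b' = c /\ kd b' = 0.
  have [e de b'e] := acM _ db' b'0.
  by exists (kmap f e); [apply: kdeg_kmap|rewrite -kmap_kd -b'e].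
case: i => [|i] in acM acA dc db *.
  by exists b; rewrite ?kd_kdeg0.
have [|a da bda] := kmap_ker (kdeg_kd db).
  by rewrite kmap_kd -def_c.
have [|a' da' def_a] := acA i erefl a da.
  apply: (@kmap_incl_inj js u).
  by rewrite kmap_kd -bda kd_kd raddf0.
exists (b - kmap (ker_incl f) a').
  by apply: kdegB => //; apply: kdeg_kmap.
split; first by rewrite raddfB /= kmap_incl_kmap subr0.
by rewrite raddfB /= -kmap_kd -def_a bda subrr.
Qed.

End KoszulExact.

(** * Criteria for the vanishing of Koszul homology *)

Section KoszulAcyclic.
Variables (F : fieldType) (n : nat).
Implicit Types (M N : gmod F n) (js : seq 'I_n) (u v w : 'X_{1..n}).

Definition maxm_on M js u : {vspace M u} :=
  (\sum_(j <- js | (0 < u j)%N) limg (gmap M (u - U_(j)) u))%VS.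

Fixpoint kemb M js u : M u -> kos M js u :=
  match js with
  | [::] => id
  | j :: js' => fun m => (kemb js' m, 0)
  end.

Fact kemb_additive M js u : zmod_morphism (@kemb M js u).
Proof. by elim: js => [|j js IH] x y //=; rewrite IH -[0 in LHS]subr0. Qed.

HB.instance Definition _ M js u :=
  GRing.isZmodMorphism.Build _ _ (@kemb M js u) (@kemb_additive M js u).

Lemma kdeg_kemb M js i u (m : M u) : (i = 0)%N -> kdeg i (kemb js m).
Proof. by move=> ->; elim: js => [|j js IH] //=. Qed.

Lemma kdeg0_kemb M js u (x : kos M js u) : kdeg 0 x -> exists m, x = kemb js m.
Proof.
elim: js x => [|j js IH] x /=; first by exists x.
by case: x => [x1 x2] /= [/IH[m ->] ->]; exists m.
Qed.

Lemma kmul_kemb M js u v (m : M u) : kmul v (kemb js m) = kemb js (gmap M u v m).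
Proof. by elim: js => [|j js IH] //=; rewrite IH raddf0. Qed.

Lemma kmap_kemb M N (f : gmorph M N) js u (m : M u) :
  kmap f (kemb js m) = kemb js (f u m).
Proof. by elim: js => [|j js IH] //=; rewrite IH raddf0. Qed.

(** A chain of degree 1 is a family of m_j in degrees u - e_j, with boundary the sum of the x_j m_j;
    so H_0 is M modulo the variables in [js]. *)
Lemma kemb_boundary M js u (m : M u) :
  (exists2 y, kdeg 1 y & kemb js m = kd y) <-> m \in maxm_on M js u.
Proof.
elim: js m => [|j js IH] m; rewrite /maxm_on ?big_nil ?big_cons.
  split=> [[y _ /= ->]|]; first exact: mem0v.
  by rewrite memv0 => /eqP ->; exists 0.
split=> [[[y1 y2] [/= d1]]|].
  case: ifP => uj d2 [def_m _]; last first.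
    by apply/IH; exists y1 => //; rewrite def_m d2 raddf0 addr0.
  have [m2 def2] := kdeg0_kemb d2.
  rewrite -[m](subrK (gmap M (u - U_(j)) u m2)) addrC memv_add ?memv_img ?memvf //.
  apply/IH; exists y1 => //; rewrite raddfB /= def_m def2 kmul_kemb addrK //.
case: ifP => uj; last first.
  case/IH => y1 d1 def_m; exists (y1, 0); rewrite /= ?uj //.
  by rewrite !raddf0 addr0 def_m.
case/memv_addP=> _ /memv_imgP[m2 _ ->] [m1 /IH[y1 d1 def_m] ->].
exists (y1, kemb js m2); first by rewrite /= uj; split=> //; apply: kdeg_kemb.
by rewrite /= kmul_kemb raddfD /= def_m addrC (kd_kdeg0 (kdeg_kemb js m2 erefl)) oppr0.
Qed.

Lemma kos_eq0 M js u (x : kos M js u) :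
  (forall v (m : M v), (v <= u)%MM -> m = 0) -> x = 0.
Proof.
elim: js u x => [|j js IH] u x M0; first exact: M0.
case: x => [x1 x2]; congr pair; apply: IH => // v m vu.
exact: M0 (lem_transi vu (lem_subl _ _)).
Qed.

Section Face.
Variables (M : gmod F n) (j : 'I_n) (u : 'X_{1..n}).

(** The face [v j = u j] of the box below u contains all degrees that the Koszul complex in
    multidegree u on variables other than x_j involves. *)
Definition face_inj := forall v (m : M (v - U_(j))%MM),
  (v <= u)%MM -> v j = u j -> gmap M (v - U_(j)) v m = 0 -> m = 0.

Definition face_surj := forall v (m : M v),
  (v <= u)%MM -> v j = u j -> exists m', m = gmap M (v - U_(j)) v m'.

(** The degree w is kept apart by an equation because the induction has to identify v - e_j - e_k
    with v - e_k - e_j, which are equal but not convertible. *)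
Lemma kmul_face_inj js v w (x : kos M js w) : face_inj -> j \notin js ->
  (v <= u)%MM -> v j = u j -> (w = v - U_(j))%MM -> kmul v x = 0 -> x = 0.
Proof.
move=> inj; elim: js v w x => [|k js IH] v w x.
  by move=> _ vu vj def_w; subst w; apply: inj.
rewrite inE negb_or => /andP[jk jjs] vu vj def_w; subst w.
case: x => [x1 x2] [x1_0 x2_0]; congr pair.
  exact: IH x1_0.
apply: IH x2_0 => //; first exact: lem_transi (lem_subl _ _) vu.
  by rewrite mnmBE mnm1E eq_sym (negPf jk) subn0.
by rewrite !submDA addmC.
Qed.

Lemma kmul_face_surj js i v w (x : kos M js v) : face_surj -> j \notin js ->
    (v <= u)%MM -> v j = u j -> (w = v - U_(j))%MM -> kdeg i x ->
  exists2 y : kos M js w, kdeg i y & x = kmul v y.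
Proof.
move=> surj; elim: js i v w x => [|k js IH] i v w x.
  move=> _ vu vj def_w /= d; subst w; have [i0|i_gt0] := posnP i.
    by have [y ->] := surj v x vu vj; exists y; rewrite // i0.
  by exists 0; rewrite ?linear0 //; apply: d.
rewrite inE negb_or => /andP[jk jjs] vu vj def_w; subst w.
have eqk : (v - U_(j))%MM k = v k by rewrite mnmBE mnm1E (negPf jk) subn0.
case: x => [x1 x2] /= [/(IH _ _ (v - U_(j))%MM)[] // y1 dy1 ->] d2.
suff [y2 dy2 ->] : exists2 y2 : kos M js (v - U_(j) - U_(k))%MM,
    (if (0 < i)%N && (0 < v k)%N then kdeg i.-1 y2 else y2 = 0) &
    x2 = kmul (v - U_(k)) y2.
  by exists (y1, y2); rewrite //= eqk.
move: d2; case: ifP => _ d2; last by exists 0; rewrite ?raddf0.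
apply: IH => //; first exact: lem_transi (lem_subl _ _) vu.
  by rewrite mnmBE mnm1E eq_sym (negPf jk) subn0.
by rewrite !submDA addmC.
Qed.
End Face.

(** The long exact sequence of a mapping cone: the second hypothesis says that x_j is injective on
    the homology of degree i - 1 for the remaining variables. *)
Lemma acyclic_cone M j js i u : acyclic M js i u ->
    (forall (b : kos M js (u - U_(j))%MM) y, (0 < i)%N -> (0 < u j)%N ->
       kdeg i.-1 b -> kd b = 0 -> kdeg i y -> kmul u b = kd y ->
     exists2 z, kdeg i z & b = kd z) ->
  acyclic M (j :: js) i u.
Proof.
move=> acM bM [a b] /= [da db] [/eqP ab_0 /eqP b0].
rewrite oppr_eq0 in b0; rewrite addrC addr_eq0 in ab_0.
move: db; case: ifP => [/andP[i_gt0 uj] db|c def_b].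
  have [||z dz def_b] := bM b (- a) i_gt0 uj db (eqP b0).
  - exact: kdegN.
  - by rewrite raddfN (eqP ab_0).
  have [||y dy ay] := acM (a + kmul u z).
  - by apply: kdegD => //; apply: kdeg_kmul.
  - by rewrite raddfD /= kd_kmul // -def_b (eqP ab_0) subrr.
  exists (y, - z); first by rewrite /= uj; split=> //; apply: kdegN.
  by rewrite /= raddfN raddfN /= opprK -def_b -ay addrK.
have [|y dy ->] := acM a da; first by move: ab_0; rewrite def_b raddf0 eq_sym oppr_eq0 => /eqP.
exists (y, 0); first by split=> //=; case: ifP => // _; apply: kdeg0.
by rewrite /= !raddf0 addr0 def_b.
Qed.

(** The cone of the bijection x_j is acyclic, and each further cone, on a variable other than x_j,
    is built from acyclic complexes. *)
Lemma acyclic_face M j js i u : uniq js -> j \in js -> (0 < u j)%N ->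
  face_inj M j u -> face_surj M j u -> acyclic M js i u.
Proof.
move=> + + + inj surj.
have : (u <= u)%MM by [].
have : u j = u j by [].
(* The multidegree v varies over the face during the induction, while the box in [inj] and [surj]
   stays the one below u. *)
move: {1 3 5 6}u => v; elim: js v i => // k js IH v i vj vu /= /andP[kjs js_uniq].
rewrite inE; case/predU1P => [def_k|jjs] v0; last first.
  have acv := IH v _ vj vu js_uniq jjs v0.
  have jk : (k == j) = false by apply/eqP => jk; rewrite jk jjs in kjs.
  apply: acyclic_cone (acv i) _ => b y i_gt0 vk db b0 _ _.
  have eqj : (v - U_(k))%MM j = v j by rewrite mnmBE mnm1E jk subn0.
  have [|||z dz ->] := IH (v - U_(k))%MM i.-1 _ _ js_uniq jjs _ b db b0.
  - by rewrite eqj.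
  - exact: lem_transi (lem_subl _ _) vu.
  - by rewrite eqj.
  by exists z; rewrite // prednK in dz *.
(* With x_j outermost, surjectivity gives a = x_j y, and injectivity turns x_j b = - kd a into b = -
   kd y; so (a, b) is the boundary of (0, y). *)
subst k => -[a b] /= [da db] [ab_0 b0].
have [y dy def_a] := kmul_face_surj surj kjs vu vj erefl da.
exists (0, y); first by rewrite /= v0; split=> //; apply: kdeg0.
rewrite /= raddf0 add0r def_a; congr pair; apply/eqP; rewrite -addr_eq0; apply/eqP.
apply: (kmul_face_inj inj kjs vu vj erefl).
by rewrite raddfD /= -kd_kmul // -def_a addrC.
Qed.

(** In top degree the first component of a cycle vanishes by [kdeg_size], so the second is killed by
    x_j: injectivity leaves no nonzero cycle. *)
Lemma acyclic_top M j js u : j \notin js -> face_inj M j u ->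
  acyclic M (j :: js) (size js).+1 u.
Proof.
move=> jjs inj [a b] /= [/kdeg_size-> // db] [+ b0]; rewrite raddf0 add0r => ub0.
have b_0 : b = 0.
  move: db; case: ifP => // uj db.
  exact: (kmul_face_inj inj jjs (lepm_refl u) erefl erefl ub0).
exists 0; first exact: (@kdeg0 _ _ M (j :: js)).
by rewrite /= !raddf0 addr0 b_0.
Qed.
End KoszulAcyclic.

(** * Koszul acyclicity of free modules *)

Section Free.
Variables (F : fieldType) (n : nat) (P : gmod F n) (g : forall v, seq (P v)).
Implicit Types (s : seq 'X_{1..n}) (js : seq 'I_n) (u v w : 'X_{1..n}).

Let fgens s u : seq (P u) := [seq gmap P v u x | v <- s, x <- g v].

Hypothesis fgens_basis : forall u, basis_of fullv (fgens (below u) u).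

Lemma fgens_cons v s u :
  fgens (v :: s) u = [seq gmap P v u x | x <- g v] ++ fgens s u.
Proof. by []. Qed.

Lemma fgens_filter p s u :
  perm_eq (fgens s u) (fgens (filter p s) u ++ fgens (filter (predC p) s) u).
Proof.
elim: s => // v s IH /=; case: (p v); rewrite /= !fgens_cons.
  by rewrite -catA perm_cat2l.
by rewrite perm_sym perm_catCA perm_cat2l perm_sym.
Qed.

Lemma fgens_map s u v : (u <= v)%MM -> {in s, forall w, (w <= u)%MM} ->
  map (gmap P u v) (fgens s u) = fgens s v.
Proof.
move=> uv su; rewrite map_allpairs; apply/eq_in_allpairs_dep => w ws x _ /=.
by rewrite gmap_comp ?su.
Qed.

Lemma fgens_splitD p u :
  (<<fgens (filter p (below u)) u>> + <<fgens (filter (predC p) (below u)) u>>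
   = fullv)%VS.
Proof.
rewrite -span_cat -(span_basis (fgens_basis u)); apply: eq_span => x.
by rewrite -(perm_mem (fgens_filter p (below u) u)).
Qed.

Lemma fgens_splitI p u :
  (<<fgens (filter p (below u)) u>> :&:
   <<fgens (filter (predC p) (below u)) u>> = 0)%VS.
Proof.
have := basis_free (fgens_basis u).
rewrite (perm_free (fgens_filter p (below u) u)) cat_free.
by case/and3P => _ _ /directv_addP.
Qed.

(** A monomial carries the basis in degree u to part of the basis in degree v; comparing dimensions
    then leaves a zero kernel. *)
Lemma gmap_free_inj u v (x : P u) :
  (u <= v)%MM -> gmap P u v x = 0 -> x = 0.
Proof.
move=> uv x0; pose s := [seq w <- below v | (w <= u)%MM].
have su : {in s, forall w, (w <= u)%MM} by move=> w; rewrite mem_filter => /andP[].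
have span_s : (<<fgens s u>> = fullv)%VS.
  rewrite -(span_basis (fgens_basis u)); apply: eq_span => y.
  apply/allpairsPdep/allpairsPdep => -[w [z [ws zw ->]]]; exists w, z; split=> //.
    by rewrite mem_below su.
  rewrite mem_below in ws.
  by rewrite mem_filter ws mem_below (lem_transi ws uv).
have free_s : free (fgens s v).
  have := basis_free (fgens_basis v).
  by rewrite (perm_free (fgens_filter (fun w => w <= u)%MM _ v)) cat_free => /and3P[].
have := limg_ker_dim (gmap P u v) fullv.
rewrite -{2}span_s limg_span fgens_map // (eqnP free_s) -(fgens_map uv su) size_map.
have := dim_span (fgens s u); rewrite span_s => le eq_dim.
have : (\dim (fullv :&: lker (gmap P u v)) <= 0)%N.
  by rewrite -(leq_add2r (size (fgens s u))) eq_dim.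
rewrite leqn0 dimv_eq0 capfv => /eqP ker0.
by apply/eqP; rewrite -memv0 -ker0 memv_ker x0.
Qed.

Lemma maxm_on_sup js u k : k \in js -> (0 < u k)%N ->
  (limg (gmap P (u - U_(k)) u) <= maxm_on P js u)%VS.
Proof. by move=> kjs uk; rewrite /maxm_on (big_rem k kjs) /= uk addvSl. Qed.

(** A basis element of degree u coming from a generator of degree v is a multiple of x_k exactly
    when v k < u k. *)
Lemma maxm_on_free js u : maxm_on P js u =
  <<fgens [seq v : 'X_{1..n} <- below u | has (fun k => v k < u k)%N js] u>>%VS.
Proof.
apply/eqP; rewrite eqEsubv; apply/andP; split.
  rewrite /maxm_on big_seq_cond.
  apply: (big_ind (fun U => U <= _)%VS) => [|U V UA VA|k /andP[kjs uk]].
  - exact: sub0v.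
  - by rewrite subv_add UA.
  rewrite -(span_basis (fgens_basis (u - U_(k)))) limg_span fgens_map //; last first.
    by move=> w; rewrite mem_below.
  apply: sub_span => x /allpairsPdep[w [z [wu zw ->]]].
  apply/allpairsPdep; exists w, z; split=> //.
  rewrite mem_below in wu.
  rewrite mem_filter mem_below (lem_transi wu (lem_subl _ _)) andbT.
  apply/hasP; exists k => //; apply: leq_ltn_trans (lem_leq wu k) _.
  by rewrite mnmBE mnm1E eqxx subn1 ltn_predL.
apply/span_subvP => _ /allpairsPdep[w [z [+ zw ->]]].
rewrite mem_filter mem_below => /andP[/hasP[k kjs wk] wu].
have wuk : (w <= u - U_(k))%MM.
  apply/mnm_lepP => l; rewrite mnmBE mnm1E; case: eqP => [<-|_]; last first.
    by rewrite subn0 (lem_leq wu).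
  by rewrite subn1 -ltnS prednK // (leq_ltn_trans _ wk).
rewrite -(gmap_comp z wuk) //.
apply: (subvP (maxm_on_sup kjs _)); first exact: leq_ltn_trans wk.
by rewrite memv_img ?memvf.
Qed.

(* The variables form a regular sequence on a free module: x_j preserves the
   coordinates on the generators, and membership in [maxm_on P js u] says that
   the coordinates on the generators v with v k = u k for all k in js vanish. *)
Lemma maxm_on_free_regular j js u (x : P (u - U_(j))%MM) : j \notin js ->
  gmap P (u - U_(j)) u x \in maxm_on P js u -> x \in maxm_on P js (u - U_(j)).
Proof.
move=> jjs; set w := (u - U_(j))%MM in x *; rewrite !maxm_on_free.
pose p (v : 'X_{1..n}) := has (fun k => v k < w k)%N js; rewrite -/p => ux.
have : x \in fullv by rewrite memvf.
rewrite -(fgens_splitD p w) => /memv_addP[a aA [c cC def_x]].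
(* Here c is the part of x on the generators that agree with w in all coordinates from [js]. *)
suff c0 : c = 0 by rewrite def_x c0 addr0.
have wu : (w <= u)%MM by apply: lem_subl.
have wk k : k \in js -> w k = u k.
  move=> kjs; rewrite mnmBE mnm1E; case: eqP => [jk|]; last by rewrite subn0.
  by rewrite jk kjs in jjs.
apply: (gmap_free_inj wu).
have img r : (gmap P w u @: <<fgens (filter r (below w)) w>> <=
    <<fgens (filter r (below u)) u>>)%VS.
  rewrite limg_span fgens_map //; last first.
    by move=> v; rewrite mem_filter mem_below => /andP[].
  apply: sub_span => y /allpairsPdep[v [z [+ zv ->]]].
  rewrite mem_filter mem_below => /andP[rv vw].
  apply/allpairsPdep; exists v, z; split=> //.
  by rewrite mem_filter mem_below rv (lem_transi vw (lem_subl _ _)).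
(* The element x_j c lies in two complementary spans: that of the generators outside [p], as c does,
   and that of those in [p], being x_j x - x_j a. Since j is not in [js], [p] means the same for w
   and for u. *)
apply/eqP; rewrite -memv0 -(fgens_splitI p u) memv_cap.
apply/andP; split; last by apply: (subvP (img _)); rewrite memv_img.
have -> : c = x - a by rewrite def_x addrC addKr.
rewrite raddfB rpredB ?(subvP (img _) _ (memv_img _ aA)) //.
rewrite (@eq_filter _ _ (fun v : 'X_{1..n} => has (fun k => v k < u k)%N js)) // => v.
by apply: eq_in_has => k /wk ->.
Qed.

(** By the cone criterion, i = 1 is regularity of x_j modulo the other variables; for larger i the
    homology of degree i - 1 vanishes by induction. *)
Lemma free_acyclic js i u : uniq js -> (0 < i)%N -> acyclic P js i u.
Proof.
elim: js i u => [|j js IH] i u /=; first by move=> _ i_gt0 x dx _; exists 0; rewrite ?dx.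
move=> /andP[jjs js_uniq] i_gt0; apply: acyclic_cone; first exact: IH.
move=> b y _ uj; case: i i_gt0 => // -[|i] _ db b0 dy bdry.
  have [m def_b] := kdeg0_kemb db; rewrite def_b in bdry *.
  apply/kemb_boundary; apply: (maxm_on_free_regular jjs).
  by apply/kemb_boundary; exists y; rewrite // -kmul_kemb.
exact: IH.
Qed.
End Free.

(** * From Koszul acyclicity to the vanishing of Tor *)

Section Tor.
Variables (F : fieldType) (n : nat).
Implicit Types (M N : gmod F n) (js : seq 'I_n) (u v w : 'X_{1..n}).

Lemma limg_maxm M N (f : gmorph M N) u : (forall v, limg (f v) = fullv) ->
  (f u @: maxm M u = maxm N u)%VS.
Proof.
move=> f_surj; rewrite limg_sum; apply: eq_bigr => j uj.
rewrite -limg_comp -[in RHS](f_surj (u - U_(j))%MM) -[in RHS]limg_comp.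
congr (_ @: _)%VS; apply/lfunP => x.
by rewrite !comp_lfunE gfun_nat.
Qed.

Lemma limg_maxm_sub M N (f : gmorph M N) u : (f u @: maxm M u <= maxm N u)%VS.
Proof.
rewrite limg_sum; apply/subv_sumP => j uj; apply: (sumv_sup j) => //.
apply/subvP => _ /memv_imgP[_ /memv_imgP[x _ ->] ->].
by rewrite gfun_nat // memv_img ?memvf.
Qed.

Lemma tensF_map_class M N (f : gmorph M N) u x :
  tensF_map f u (subq_class fullv (maxm M u) x) =
  subq_class fullv (maxm N u) (f u x).
Proof. by rewrite /tensF_map subq_map_class ?subvf ?memvf ?limg_maxm_sub. Qed.

(** The quotient is realised on a complement inside Z, so it makes sense for any two subspaces and
    vanishes once Z lies in B. *)
Lemma dim_subq_eq0 (vT : vectType F) (Z B : {vspace vT}) :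
  (Z <= B)%VS -> \dim {: Defs.subq Z B} = 0%N.
Proof.
move=> ZB; have := dimv_cap_compl Z B; rewrite (capv_idPl ZB) dimvf => /eqP.
by rewrite -[X in _ == X]addn0 eqn_add2l => /eqP.
Qed.

Lemma maxmE M js u : uniq js -> (forall j, j \in js) -> maxm M u = maxm_on M js u.
Proof.
move=> js_uniq js_full; apply/perm_big/uniq_perm; rewrite ?index_enum_uniq //.
by move=> j; rewrite mem_index_enum js_full.
Qed.

(** Right exactness of the tensor product with F: x differs from an element y of mP by an element of
    ker f = im d. *)
Lemma limg_tensF_map (Q P N : gmod F n) (d : gmorph Q P) (f : gmorph P N) u
    (x : P u) : (forall v, limg (f v) = fullv) -> limg (d u) = lker (f u) ->
  f u x \in maxm N u ->
  subq_class fullv (maxm P u) x \in limg (tensF_map d u).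
Proof.
move=> f_surj ex; rewrite -(limg_maxm u f_surj) => /memv_imgP[y ym fxy].
have : x - y \in lker (f u) by rewrite memv_ker linearB /= fxy subrr.
rewrite -ex => /memv_imgP[z _ def_z].
have -> : subq_class fullv (maxm P u) x = subq_class fullv (maxm P u) (x - y).
  apply/esym/eqP; rewrite linearB /= -subr_eq0 addrAC subrr add0r oppr_eq0.
  by rewrite subq_class_eq0 ?subvf ?memvf.
by rewrite def_z -tensF_map_class memv_img ?memvf.
Qed.

(** * Differentials corestricted to kernels, and the shifted resolution *)

Section Corestriction.
Variables (Q M N : gmod F n) (d : gmorph Q M) (f : gmorph M N).
Hypothesis fd0 : forall u, limg (d u) = lker (f u).

Let corestr_fun u : 'Hom(Q u, gker f u) := (linfun (vsproj (lker (f u))) \o d u)%VF.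

Let corestr_funE u x : vsval (corestr_fun u x) = d u x.
Proof. by rewrite comp_lfunE lfunE /= vsprojK // -fd0 memv_img ?memvf. Qed.

Fact corestr_nat u v x : (u <= v)%MM ->
  corestr_fun v (gmap Q u v x) = gmap (gker f) u v (corestr_fun u x).
Proof.
move=> uv; apply: subvs_inj; rewrite corestr_funE [RHS]ker_mapE //.
by rewrite corestr_funE gfun_nat.
Qed.

Definition corestr : gmorph Q (gker f) := GMorph corestr_nat.

Lemma corestrE u x : ker_incl f u (corestr u x) = d u x.
Proof. by rewrite lfunE; apply: corestr_funE. Qed.

Lemma corestr_surj u : limg (corestr u) = fullv.
Proof.
apply/eqP; rewrite eqEsubv subvf; apply/subvP => x _.
have: vsval x \in limg (d u) by rewrite fd0 subvsP.
case/memv_imgP=> y _ def_x; apply/memv_imgP; exists y; rewrite ?memvf //.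
by apply: subvs_inj; rewrite def_x -corestr_funE.
Qed.

Lemma lker_corestr u : lker (corestr u) = lker (d u).
Proof.
apply/vspaceP => x; rewrite !memv_ker -(inj_eq subvs_inj) [vsval _]corestr_funE.
by rewrite linear0.
Qed.

End Corestriction.

Section Tail.
Variables (M : gmod F n) (R : free_resolution M).

Let aug := corestr (@res_exact0 _ _ _ R).

Fact tail_exact0 u : limg (res_d R 1 u) = lker (aug u).
Proof. by rewrite lker_corestr; apply: res_exactS. Qed.

Definition tail_resolution : free_resolution (gker (res_aug R)) :=
  FreeResolution (fun i => res_free R i.+1)
    (corestr_surj (@res_exact0 _ _ _ R)) tail_exact0
    (fun i => @res_exactS _ _ _ R i.+1).

End Tail.

(* Dimension shifting: passing to [tail_resolution] lowers i by one on both
   sides, the free module being Koszul-acyclic in positive degrees. *)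
Lemma acyclic_tor M (R : free_resolution M) js i u :
  uniq js -> (forall j, j \in js) -> acyclic M js i u ->
  \dim {: tor_of R i u} = 0%N.
Proof.
move=> js_uniq js_full; have [k] := ubnP i; elim: k M R i => // k IH M R [|[|i]] k_ge acM.
- apply/dim_subq_eq0/subvP => t _; have [x _ ->] := subq_class_surj t.
  apply: (limg_tensF_map (@res_aug_surj _ _ _ R) (@res_exact0 _ _ _ R u)).
  rewrite (maxmE _ _ js_uniq js_full); apply/kemb_boundary.
  by apply: acM; [|rewrite kd_kdeg0 //]; apply: kdeg_kemb.
(* Degree 1 is done by hand, since its cycles are a kernel whereas those of degree 0 are the whole
   space. A cycle x maps into m times the first free module, and [boundary_ker] moves this
   membership into the first syzygy. *)
- apply/dim_subq_eq0/subvP => t; have [x _ ->] := subq_class_surj t.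
  rewrite memv_ker tensF_map_class subq_class_eq0 ?subvf ?memvf // => dx.
  apply: (limg_tensF_map (corestr_surj (@res_exact0 _ _ _ R)) (tail_exact0 R u)).
  rewrite (maxmE _ _ js_uniq js_full); apply/kemb_boundary.
  move: dx; rewrite (maxmE _ _ js_uniq js_full) => /kemb_boundary[y dy def_y].
  apply: (boundary_ker (@res_aug_surj _ _ _ R) acM _ dy); first exact: kdeg_kemb.
  by rewrite kmap_kemb corestrE.
(* From degree 2 on, [tor_of] along the resolution and along its tail agree by definition. *)
have [g g_basis] := res_free R 0.
apply: (IH _ (tail_resolution R) i.+1).
  exact: k_ge.
apply: (acyclic_ker (@res_aug_surj _ _ _ R) acM).
exact: free_acyclic g_basis _ _ _ js_uniq _.
Qed.

End Tor.

(** * Graded modules of subspaces of a fixed space *)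

Section FaceStable.
Variables (F : fieldType) (n : nat) (vT : vectType F).
Implicit Types (W : 'X_{1..n} -> {vspace vT}) (u v : 'X_{1..n}).

(** The two ways in which u can fail to be a join of grades: nothing lives below u, or nothing new
    appears at the coordinate u j. Images and intersections preserve this, which carries it from
    chains to boundaries and cycles. *)
Definition face_stable W u : Prop :=
  (forall v, (v <= u)%MM -> W v = 0%VS) \/
  exists2 j, (0 < u j)%N &
    forall v, (v <= u)%MM -> v j = u j -> (W v <= W (v - U_(j))%MM)%VS.

Lemma face_stable_img W (f : 'End(vT)) u :
  face_stable W u -> face_stable (fun v => f @: W v)%VS u.
Proof.
case=> [W0|[j uj Wj]]; [left=> v vu|right; exists j => // v vu vj].
  by rewrite W0 // limg0.
by rewrite limgS ?Wj.
Qed.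

Lemma face_stable_cap W (K : {vspace vT}) u :
  face_stable W u -> face_stable (fun v => W v :&: K)%VS u.
Proof.
case=> [W0|[j uj Wj]]; [left=> v vu|right; exists j => // v vu vj].
  by rewrite W0 // cap0v.
by rewrite capvS ?Wj.
Qed.

(** Inside [vT] every x_j is an inclusion, hence injective; stability makes one of them surjective
    on its face. *)
Lemma face_stable_acyclic (M : gmod F n) (e : forall u, 'Hom(M u, vT)) W
    js i u :
    (forall v, injective (e v)) -> (forall v, limg (e v) = W v) ->
    (forall v w x, (v <= w)%MM -> e w (gmap M v w x) = e v x) ->
    face_stable W u -> uniq js -> (forall j, j \in js) ->
  acyclic M js i u.
Proof.
move=> e_inj e_img e_nat [W0|[j uj Wj]] js_uniq js_full.
  move=> x _ _; exists 0; first exact: kdeg0.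
  rewrite raddf0; apply: kos_eq0 => v m vu; apply: (e_inj v).
  by apply/eqP; rewrite linear0 -memv0 -(W0 v vu) -e_img memv_img ?memvf.
apply: (acyclic_face js_uniq (js_full j) uj) => [v m vu vj m0|v m vu vj].
  by apply: (e_inj (v - U_(j))%MM); rewrite linear0 -(e_nat _ v) // m0 linear0.
have : e v m \in limg (e (v - U_(j))%MM).
  by rewrite e_img (subvP (Wj v vu vj)) // -e_img memv_img ?memvf.
case/memv_imgP=> m' _ def_m; exists m'; apply: (e_inj v).
by rewrite def_m e_nat.
Qed.

Variables (W : 'X_{1..n} -> {vspace vT}).
Hypothesis W_mono : forall u v, (u <= v)%MM -> (W u <= W v)%VS.

Let sub_map u v : 'Hom(subvs_of (W u), subvs_of (W v)) :=
  (linfun (vsproj (W v)) \o linfun vsval)%VF.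

Let sub_mapE u v x : (u <= v)%MM -> vsval (sub_map u v x) = vsval x.
Proof.
by move=> uv; rewrite comp_lfunE !lfunE /= vsprojK // (subvP (W_mono uv)) ?subvsP.
Qed.

Fact sub_map_id u x : sub_map u u x = x.
Proof. by apply: subvs_inj; rewrite sub_mapE. Qed.

Fact sub_map_comp u v w x : (u <= v)%MM -> (v <= w)%MM ->
  sub_map v w (sub_map u v x) = sub_map u w x.
Proof.
move=> uv vw; apply: subvs_inj.
by rewrite !sub_mapE // (lem_transi uv vw).
Qed.

Definition sub_gmod : gmod F n :=
  @GMod F n (fun u => subvs_of (W u) : vectType F) sub_map sub_map_id sub_map_comp.

Definition sub_val u : 'Hom(sub_gmod u, vT) := linfun vsval.

Lemma sub_val_inj u : injective (sub_val u).
Proof. by move=> x y; rewrite !lfunE; apply: subvs_inj. Qed.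

Lemma limg_sub_val u : limg (sub_val u) = W u.
Proof.
apply/vspaceP => x; apply/memv_imgP/idP => [[y _ ->]|xW].
  by rewrite lfunE subvsP.
by exists (vsproj (W u) x); rewrite ?memvf // lfunE /= vsprojK.
Qed.

Lemma sub_val_nat u v x : (u <= v)%MM ->
  sub_val v (gmap sub_gmod u v x) = sub_val u x.
Proof. by move=> uv; rewrite [LHS]lfunE [RHS]lfunE; apply: sub_mapE. Qed.

End FaceStable.

(** * Cycles, boundaries and homology of a one-critical filtration *)

Section FiltrationHomology.
Variables (F : fieldType) (n : nat) (X : cellComplex F) (Xf : filtration n X).
Implicit Types (q : nat) (u v : 'X_{1..n}).

Lemma join_closure_or_face_stable q u : one_critical Xf ->
  join_closure (grades Xf q) u \/ face_stable (fun v => Cq q (Xf v)) u.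
Proof.
case=> h [h_mono XfE].
pose L := [seq h s | s <- enum X & (cdim s == q) && (h s <= u)%MM].
have memL s v : cdim s == q -> s \in Xf v -> (v <= u)%MM -> h s \in L.
  rewrite XfE inE => sq hv vu; apply: map_f.
  by rewrite mem_filter sq mem_enum (lem_transi hv vu).
(* The empty list is set aside first: its join 0 could equal u, but [join_closure] admits only
   nonempty lists. *)
have [L0|Ln0] := eqVneq L [::].
  right; left=> v vu; apply: big1 => s /andP[sv sq].
  by have := memL s v sq sv vu; rewrite L0.
pose w := \big[@mlcm n/0%MM]_(g <- L) g.
have le_w g : g \in L -> (g <= w)%MM.
  rewrite /w; elim: {memL Ln0 w}L => // v s IH.
  rewrite inE big_cons => /predU1P[->|/IH gs]; first exact: lem_mlcml.
  exact: lem_transi gs (lem_mlcmr _ _).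
have wu : (w <= u)%MM.
  rewrite /w big_seq; apply: (big_ind (fun v => v <= u)%MM).
  - by apply/mnm_lepP => k; rewrite mnm0E.
  - by move=> v1 v2 h1 h2; rewrite lem_mlcm h1.
  - by move=> g /mapP[s + ->]; rewrite mem_filter => /andP[/andP[]].
have [def_u|w_neq_u] := eqVneq u w.
  left; exists L; split=> //; first exact/eqP.
  move=> g /mapP[s + ->]; rewrite mem_filter => /andP[/andP[/eqP sq _] _].
  exists s; split=> //; split; first by rewrite XfE inE.
  move=> j hj; rewrite XfE inE; apply/negP => /lem_leq/(_ j).
  by rewrite mnmBE mnm1E eqxx subn1 leqNgt ltn_predL hj.
right; right.
have [j wj] : exists j, (w j < u j)%N.
  apply/existsP; apply: contraR w_neq_u => /existsPn wu'.
  apply/eqP/mnmP => j; apply/eqP; rewrite eqn_leq (lem_leq wu) andbT leqNgt.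
  exact: wu'.
exists j; first exact: leq_ltn_trans wj.
(* A q-cell s of X^v has grade at most v, and its coordinate j is at most w j < u j = v j; so s
   already lies in X^(v - e_j). *)
move=> v vu vj; apply/subv_sumP => s /andP[sv sq]; apply: (sumv_sup s) => //.
rewrite sq andbT XfE inE; have hw := le_w _ (memL s v sq sv vu).
rewrite XfE inE in sv; apply/mnm_lepP => k; rewrite mnmBE mnm1E.
case: eqP => [<-|_]; last by rewrite subn0 (lem_leq sv).
rewrite subn1 vj -ltnS prednK ?(leq_ltn_trans _ wj) //; exact: lem_leq.
Qed.

Lemma Zq_mono q u v : (u <= v)%MM -> (Zq q (Xf u) <= Zq q (Xf v))%VS.
Proof. by move=> uv; rewrite capvS ?Cq_mono ?fil_mono. Qed.

Lemma Bq_mono q u v : (u <= v)%MM -> (Bq q (Xf u) <= Bq q (Xf v))%VS.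
Proof. by move=> uv; rewrite limgS ?Cq_mono ?fil_mono. Qed.

Definition cycle_gmod q : gmod F n := sub_gmod (@Zq_mono q).

Definition cycle_class q u : 'Hom(cycle_gmod q u, fil_homology Xf q u) :=
  (subq_class (Zq q (Xf u)) (Bq q (Xf u)) \o sub_val (@Zq_mono q) u)%VF.

Fact cycle_class_nat q u v x : (u <= v)%MM ->
  cycle_class q v (gmap (cycle_gmod q) u v x) =
  gmap (fil_homology Xf q) u v (cycle_class q u x).
Proof.
move=> uv; rewrite comp_lfunE sub_val_nat // [cycle_class q u x]comp_lfunE.
rewrite [RHS]subq_map_class ?id_lfunE ?lim1g ?Bq_mono ?Zq_mono //.
  exact/Bq_sub_Zq/fil_sub.
by rewrite -(limg_sub_val (@Zq_mono q)) memv_img ?memvf.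
Qed.

Definition cycle_proj q : gmorph (cycle_gmod q) (fil_homology Xf q) :=
  GMorph (@cycle_class_nat q).

Lemma cycle_proj_surj q u : limg (cycle_proj q u) = fullv.
Proof.
apply/eqP; rewrite eqEsubv subvf; apply/subvP => x _.
have [z zZ ->] := subq_class_surj x.
have /memv_imgP[y _ ->] : z \in limg (sub_val (@Zq_mono q) u).
  by rewrite limg_sub_val.
by apply/memv_imgP; exists y; rewrite ?memvf ?comp_lfunE.
Qed.

Lemma cycle_acyclic q js i u : face_stable (fun v => Cq q (Xf v)) u ->
  uniq js -> (forall j, j \in js) -> acyclic (cycle_gmod q) js i u.
Proof.
move=> st; apply: face_stable_acyclic (face_stable_cap (lker (bdry X)) st).
- exact: sub_val_inj.
- exact: limg_sub_val.
- by move=> v w x; apply: sub_val_nat.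
Qed.

(** The kernel of [cycle_proj q] is the module of boundaries: its image among the chains is
    [Bq q (Xf v)], the image of the (q+1)-chains. *)
Lemma boundary_acyclic q js i u : face_stable (fun v => Cq q.+1 (Xf v)) u ->
  uniq js -> (forall j, j \in js) -> acyclic (gker (cycle_proj q)) js i u.
Proof.
move=> st; apply: (face_stable_acyclic
    (e := fun v => sub_val (@Zq_mono q) v \o ker_incl (cycle_proj q) v)%VF)
  (face_stable_img (bdry X) st) => [v x y|v|v w x vw].
- rewrite 2!comp_lfunE => /sub_val_inj; rewrite !lfunE; exact: subvs_inj.
- have BZ := Bq_sub_Zq q (@fil_sub _ _ _ Xf v).
  have kerE x : (x \in lker (cycle_proj q v)) = (sub_val (@Zq_mono q) v x \in Bq q (Xf v)).
    rewrite memv_ker comp_lfunE subq_class_eq0 //.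
    by rewrite -(limg_sub_val (@Zq_mono q)) memv_img ?memvf.
  rewrite limg_comp; apply/vspaceP => z; apply/memv_imgP/idP => [[x + ->]|zB].
    by rewrite limg_ker_incl kerE.
  have := subvP BZ _ zB; rewrite -(limg_sub_val (@Zq_mono q)).
  by case/memv_imgP=> x _ def_z; exists x; rewrite // limg_ker_incl kerE -def_z.
rewrite 2!comp_lfunE.
have -> : ker_incl (cycle_proj q) w (gmap (gker (cycle_proj q)) v w x) =
    gmap (cycle_gmod q) v w (ker_incl (cycle_proj q) v x) by exact: gfun_nat.
exact: sub_val_nat.
Qed.

(** A cycle of X^(v - e_j) that bounds in X^v already bounds in X^(v - e_j) by the hypothesis on
    boundaries. *)
Lemma homology_face_inj q j u :
  (forall v, (v <= u)%MM -> v j = u j -> (Bq q (Xf v) <= Bq q (Xf (v - U_(j))%MM))%VS) ->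
  face_inj (fil_homology Xf q) j u.
Proof.
move=> Bj v m vu vj; have [z zZ ->] := subq_class_surj m.
have le : (v - U_(j) <= v)%MM by [].
have BZ w := Bq_sub_Zq q (@fil_sub _ _ _ Xf w).
rewrite -[gmap _ _ _ _]/(subq_map _ _ _ _ _ _) subq_map_class ?lim1g ?Bq_mono ?Zq_mono //.
rewrite id_lfunE => /eqP; rewrite subq_class_eq0 // => [zB|]; last first.
  exact: subvP (Zq_mono q le) _ zZ.
by apply/eqP; rewrite subq_class_eq0 // (subvP (Bj v vu vj)).
Qed.

Lemma homology_acyclic_top q u : (0 < n)%N ->
    face_stable (fun v => Cq q.+1 (Xf v)) u ->
  exists js : seq 'I_n, [/\ uniq js, forall j, j \in js
    & acyclic (fil_homology Xf q) js n u].
Proof.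
move=> n_gt0 st.
have [j Bj] : exists j, forall v, (v <= u)%MM -> v j = u j ->
    (Bq q (Xf v) <= Bq q (Xf (v - U_(j))%MM))%VS.
  case: (face_stable_img (bdry X) st) => [B0|[j _ Bj]]; last by exists j.
  (* Without boundaries below u any coordinate will do, and n > 0 provides one. *)
  by exists (Ordinal n_gt0) => v vu _; rewrite [Bq q (Xf v)]B0 ?sub0v.
(* The coordinate j comes first, as [acyclic_top] needs the cone of x_j outermost; [acyclic_tor]
   accepts every enumeration of the variables. *)
exists (j :: rem j (enum 'I_n)).
have perm_js : perm_eq (j :: rem j (enum 'I_n)) (enum 'I_n).
  by rewrite perm_sym perm_to_rem ?mem_enum.
split=> [|k|]; first by rewrite (perm_uniq perm_js) enum_uniq.
  by rewrite (perm_mem perm_js) mem_enum.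
have size_js : (size (rem j (enum 'I_n))).+1 = n.
  by rewrite -[RHS](size_enum_ord n) -(perm_size perm_js).
rewrite -[X in acyclic _ _ X _]size_js; apply: acyclic_top; last exact: homology_face_inj.
by rewrite mem_rem_uniqF ?enum_uniq.
Qed.

End FiltrationHomology.

Theorem theorem5p10 (F : fieldType) (n : nat) (hn : (1 <= n)%N)
    (X : cellComplex F) (Xf : filtration n X)
    (hcrit : one_critical Xf) (hexh : exhaustive Xf) :
  (forall (q : nat) (u : 'X_{1..n}),
     (exists i : nat, (i <= n)%N /\ supp (xi Xf q i) u) ->
     join_closure (grades Xf q.+1) u \/ join_closure (grades Xf q) u)
  /\ (forall (q : nat) (u : 'X_{1..n}),
       supp (xi Xf q 0) u -> join_closure (grades Xf q) u)
  /\ (forall (q : nat) (u : 'X_{1..n}),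
       supp (xi Xf q n) u -> join_closure (grades Xf q.+1) u).
Proof.
have enum_full j : j \in enum 'I_n by rewrite mem_enum.
have xi_eq0 q i u : acyclic (fil_homology Xf q) (enum 'I_n) i u -> xi Xf q i u = 0%N.
  exact: acyclic_tor (enum_uniq _) enum_full.
split=> [q u [i [_ xi_neq0]]|].
  have [|stB] := join_closure_or_face_stable q.+1 u hcrit; first by left.
  have [|stZ] := join_closure_or_face_stable q u hcrit; first by right.
  case: xi_neq0; apply: xi_eq0.
  apply: (acyclic_quot (@cycle_proj_surj _ _ _ Xf q)) => [|k _].
    exact: cycle_acyclic stZ (enum_uniq _) enum_full.
  exact: boundary_acyclic stB (enum_uniq _) enum_full.
split=> q u xi_neq0.
  have [//|stZ] := join_closure_or_face_stable q u hcrit.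
  case: xi_neq0; apply: xi_eq0.
  (* In degree 0 the condition on boundaries is vacuous, so only the q-cells matter. *)
  apply: (acyclic_quot (@cycle_proj_surj _ _ _ Xf q)) => //.
  exact: cycle_acyclic stZ (enum_uniq _) enum_full.
have [//|stB] := join_closure_or_face_stable q.+1 u hcrit.
have [js [js_uniq js_full acV]] := homology_acyclic_top hn stB.
by case: xi_neq0; apply: acyclic_tor js_uniq js_full acV.
Qed.
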